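(* Let $\mathcal{C}=(\mathrm{A},\Gamma)$ be a contract. If $\mathcal{C}$ is consistent, then $\mathfrak{B}_{\mathrm i}(\mathrm{A})\subset\mathfrak{B}_{\mathrm i}(\Gamma)$, and there exist guarantees $$\Gamma': G'\left(\tfrac{d}{dt}\right)y=H'\left(\tfrac{d}{dt}\right)u$$ with polynomial matrices $G'(s),H'(s)$ such that $G'(s)$ has full row rank and $\mathfrak{B}(\mathrm{A}\wedge\Gamma)=\mathfrak{B}(\mathrm{A}\wedge\Gamma')$.
   Context: Fix numbers $m$ of inputs and $p$ of outputs. $\mathcal{C}^\infty_n$ denotes the space of smooth functions $\mathbb{R}\to\mathbb{R}^n$. All polynomials are univariate with real coefficients; polynomial (rational) matrices are matrices with polynomial (rational function) entries. Polynomial matrices are allowed to have zero rows (empty systems of equations). Full row rank means full row rank over the field of rational functions. A rational function is proper if the degree of its denominator is at least the degree of its numerator; a rational matrix is proper if all its entries are. A square polynomial matrix $P(s)$ is invertible if it has an inverse that is a rational matrix. The symbol $\subset$ denotes (not necessarily strict) inclusion. Systems. A system $\Sigma: P\left(\tfrac{d}{dt}\right) y = Q\left(\tfrac{d}{dt}\right) u$, with $u\in\mathcal{C}^\infty_m$, $y\in\mathcal{C}^\infty_p$ and $P(s),Q(s)$ polynomial matrices, is in input-output form if $P(s)$ is (square and) invertible and $P(s)^{-1}Q(s)$ is proper. Its external behaviour is $\mathfrak{B}(\Sigma)=\{(u,y)\in\mathcal{C}^\infty_{m+p} : P(\tfrac{d}{dt})y=Q(\tfrac{d}{dt})u\}$.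 Environments and assumptions. An environment $\mathrm{E}$ is a system $0=E\left(\tfrac{d}{dt}\right)u$ with $u\in\mathcal{C}^\infty_m$ and $E(s)$ a polynomial matrix; its input behaviour is $\mathfrak{B}_{\mathrm i}(\mathrm{E})=\{u\in\mathcal{C}^\infty_m : E(\tfrac{d}{dt})u=0\}$. Assumptions $\mathrm{A}$ are a system of the same form, $0=A\left(\tfrac{d}{dt}\right)u$ with $A(s)$ a polynomial matrix, with input behaviour $\mathfrak{B}_{\mathrm i}(\mathrm{A})$ defined in the same way. Guarantees. Guarantees $\Gamma$ are a system $G\left(\tfrac{d}{dt}\right)y=H\left(\tfrac{d}{dt}\right)u$ with $u\in\mathcal{C}^\infty_m$, $y\in\mathcal{C}^\infty_p$ and arbitrary polynomial matrices $G(s),H(s)$; its external behaviour is $\mathfrak{B}(\Gamma)=\{(u,y)\in\mathcal{C}^\infty_{m+p}: G(\tfrac{d}{dt})y=H(\tfrac{d}{dt})u\}$, and its input behaviour is the projection $\mathfrak{B}_{\mathrm i}(\Gamma)=\{u\in\mathcal{C}^\infty_m : \exists y\in\mathcal{C}^\infty_p \text{ such that } (u,y)\in\mathfrak{B}(\Gamma)\}$. Interconnection. For an environment (or assumptions) $\mathrm{E}$ and a system or guarantees $\mathrm{F}$ in the variables $(u,y)$, $\mathrm{E}\wedge \mathrm{F}$ is the system obtained by imposing both sets of equations, so $\mathfrak{B}(\mathrm{E}\wedge \mathrm{F})=\{(u,y)\in\mathfrak{B}(\mathrm{F}): u\in\mathfrak{B}_{\mathrm i}(\mathrm{E})\}$.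 Contracts. A contract $\mathcal{C}=(\mathrm{A},\Gamma)$ is a pair of assumptions $\mathrm{A}$ and guarantees $\Gamma$. An environment $\mathrm{E}$ is compatible with $\mathcal{C}$ if $\mathfrak{B}_{\mathrm i}(\mathrm{E})\subset\mathfrak{B}_{\mathrm i}(\mathrm{A})$. A system $\Sigma$ in input-output form implements $\mathcal{C}$ (is an implementation of $\mathcal{C}$) if $\mathfrak{B}(\mathrm{E}\wedge\Sigma)\subset\mathfrak{B}(\Gamma)$ for all environments $\mathrm{E}$ compatible with $\mathcal{C}$. A contract is consistent if it has at least one implementation. *)

(* Defs.v *)
From HB Require Import structures.
From mathcomp Require Import all_boot all_order all_algebra.
From mathcomp Require Import all_classical all_reals all_analysis.

Set Implicit Arguments.
Unset Strict Implicit.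
Unset Printing Implicit Defensive.

Import Order.TTheory GRing.Theory Num.Theory.
Import numFieldNormedType.Exports.

Local Open Scope classical_set_scope.
Local Open Scope ring_scope.

(* Smoothness and differentiation of vector-valued functions are taken
   componentwise; the dimension n may be 0. *)
Definition smooth (R : realType) (n : nat) : set (R -> 'cV[R]_n) :=
  [set f : R -> 'cV[R]_n | forall (i : 'I_n) (k : nat) (t : R),
     derivable (derive1n k (fun s : R => f s i 0)) t 1].

(* q(d/dt) f, for a scalar function f *)
Definition poly_ddt (R : realType) (q : {poly R}) (f : R -> R) : R -> R :=
  fun t => \sum_(k < size q) q`_k * derive1n k f t.

(* M(d/dt) f *)
Definition mx_ddt (R : realType) (r n : nat) (M : 'M[{poly R}]_(r, n))
    (f : R -> 'cV[R]_n) : R -> 'cV[R]_r :=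
  fun t => \col_i \sum_j poly_ddt (M i j) (fun s : R => f s j 0) t.

Definition ratmx (R : realType) (r n : nat) (M : 'M[{poly R}]_(r, n)) :
    'M[{fraction {poly R}}]_(r, n) :=
  map_mx (@tofrac _) M.

(* size is degree + 1 (and 0 for the zero polynomial), so comparing sizes is
   comparing degrees; the comparison does not depend on the choice of a, b. *)
Definition proper_frac (R : realType) (x : {fraction {poly R}}) : Prop :=
  exists a b : {poly R},
    [/\ b != 0, x = tofrac a / tofrac b & (size a <= size b)%N].

Definition proper_mx (R : realType) (r n : nat)
    (M : 'M[{fraction {poly R}}]_(r, n)) : Prop :=
  forall i j, proper_frac (M i j).

Definition full_row_rank (R : realType) (r n : nat) (M : 'M[{poly R}]_(r, n)) :
    Prop :=
  row_free (ratmx M).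

(* Environments and assumptions: 0 = E(d/dt) u; no equations if env_rows = 0. *)
Record environment (R : realType) (m : nat) := Environment {
  env_rows : nat;
  env_mx : 'M[{poly R}]_(env_rows, m) }.

(* Systems and guarantees: P(d/dt) y = Q(d/dt) u, with m inputs u and
   p outputs y. *)
Record system (R : realType) (m p : nat) := System {
  sys_rows : nat;
  out_mx : 'M[{poly R}]_(sys_rows, p);
  in_mx : 'M[{poly R}]_(sys_rows, m) }.

Definition env_behaviour (R : realType) (m : nat) (E : environment R m) :
    set (R -> 'cV[R]_m) :=
  [set u | smooth u /\ mx_ddt (env_mx E) u = (fun=> 0)].

Definition behaviour (R : realType) (m p : nat) (S : system R m p) :
    set ((R -> 'cV[R]_m) * (R -> 'cV[R]_p)) :=
  [set uy | [/\ smooth uy.1, smooth uy.2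
     & mx_ddt (out_mx S) uy.2 = mx_ddt (in_mx S) uy.1]].

Definition input_behaviour (R : realType) (m p : nat) (S : system R m p) :
    set (R -> 'cV[R]_m) :=
  [set u | exists y, behaviour S (u, y)].

Definition io_form (R : realType) (m p : nat) (S : system R m p) : Prop :=
  exists (P : 'M[{poly R}]_p) (Q : 'M[{poly R}]_(p, m)),
    [/\ S = System P Q,
        ratmx P \in unitmx
      & proper_mx (invmx (ratmx P) *m ratmx Q)].

(* The stacked equations 0 = E(d/dt) u and P(d/dt) y = Q(d/dt) u. *)
Definition interconnect (R : realType) (m p : nat) (E : environment R m)
    (S : system R m p) : system R m p :=
  System (col_mx (0 : 'M[{poly R}]_(env_rows E, p)) (out_mx S))
         (col_mx (env_mx E) (in_mx S)).

Lemma behaviour_interconnect (R : realType) (m p : nat) (E : environment R m)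
    (S : system R m p) :
  behaviour (interconnect E S) =
  [set uy | behaviour S uy /\ env_behaviour E uy.1].
Proof.
apply/seteqP; split=> -[u y] /=.
  move=> [su sy /= eq_uy]; split; split=> //=; apply/funext => t;
    apply/matrixP => i j; move/(congr1 (fun f => f t)): eq_uy => /matrixP eq_t.
    have := eq_t (rshift _ i) j; rewrite !mxE.
    by under eq_bigr do rewrite col_mxEd; under [in RHS]eq_bigr do
      rewrite col_mxEd.
  have := eq_t (lshift _ i) j; rewrite !mxE.
  under eq_bigr do rewrite col_mxEu mxE /poly_ddt size_poly0 big_ord0.
  by under [in RHS]eq_bigr do rewrite col_mxEu; rewrite big1.
move=> [[su sy /= eqS] [_ /= eqE]]; split=> //=; apply/funext => t.
apply/matrixP => i j; rewrite !mxE; case: (split_ordP i) => k -> {i}.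
  move/(congr1 (fun f => f t)): eqE => /matrixP/(_ k j); rewrite !mxE => eqE.
  under eq_bigr do rewrite col_mxEu mxE /poly_ddt size_poly0 big_ord0.
  by under [in RHS]eq_bigr do rewrite col_mxEu; rewrite eqE big1.
move/(congr1 (fun f => f t)): eqS => /matrixP/(_ k j); rewrite !mxE => eqS.
by under eq_bigr do rewrite col_mxEd; under [in RHS]eq_bigr do
  rewrite col_mxEd.
Qed.

Record io_contract (R : realType) (m p : nat) := IOContract {
  assumptions : environment R m;
  guarantees : system R m p }.

Definition compatible (R : realType) (m p : nat) (E : environment R m)
    (C : io_contract R m p) : Prop :=
  env_behaviour E `<=` env_behaviour (assumptions C).

Definition implements (R : realType) (m p : nat) (S : system R m p)
    (C : io_contract R m p) : Prop :=
  io_form S /\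
  forall E : environment R m, compatible E C ->
    behaviour (interconnect E S) `<=` behaviour (guarantees C).

Definition consistent (R : realType) (m p : nat) (C : io_contract R m p) :
    Prop :=
  exists S : system R m p, implements S C.

(* Main.v *)
Require Import Defs.
From HB Require Import structures.
From mathcomp Require Import generic_quotient fraction complex.
From mathcomp Require Import all_boot all_order all_algebra.
From mathcomp Require Import all_classical all_reals all_analysis.
From mathcomp Require Import ring lra.

Import Order.TTheory GRing.Theory Num.Theory.
Import numFieldNormedType.Exports.

Local Open Scope classical_set_scope.
Local Open Scope ring_scope.

(** The assumptions form an environment compatible with the contract, so an
    implementation P(d/dt) y = Q(d/dt) u can be run in it. For u satisfying the
    assumptions, P(d/dt) y = Q(d/dt) u has a smooth solution y, because a square
    operator P(d/dt) with nonzero determinant is onto the smooth functions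
    ([mx_ddt_onto]); the implementation property then says that (u, y)
    satisfies the guarantees. This is the inclusion of input behaviours.

    Surjectivity of P(d/dt) reduces to the scalar case through the adjugate:
    if det P (d/dt) z = f entrywise then y = adj P (d/dt) z is a solution. A
    nonzero real polynomial is a product of a constant and of factors X - a and
    (X - a)^2 + b^2, and operators that are onto compose to an operator that is
    onto, so it suffices to treat these factors. Both are covered by the single
    complex equation z' = (a + i b) z + f, written as a pair of real equations
    and solved by variation of constants ([pair_system_onto]).

    For the second claim, suppose that the rows of G are dependent over the
    rational functions. After clearing denominators, c G = 0 for a nonzero
    polynomial row c. The Euclidean algorithm performed by unimodular column
    operations leaves c with one nonzero entry, and the inverse operations on
    the rows of G produce a zero row ([unimodular_zero_row]). Multiplying
    G(d/dt) y = H(d/dt) u by a unimodular matrix does not change its solutions,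
    and the equation with zero left-hand side, 0 = h(d/dt) u, holds for every u
    that admits some y, hence, by the first claim, for every u that satisfies
    the assumptions. Deleting it changes nothing there, and the number of rows
    decreases until the rank is full ([full_row_rank_reduction]). *)

(** * The action of polynomials in d/dt on smooth functions *)

Section Scalar.
Context {R : realType}.
Implicit Types (f g : R -> R) (p q : {poly R}).

Definition smooth1 f := forall k t, derivable (derive1n k f) t 1.

Lemma smooth1_derive1 {f} : smooth1 f -> smooth1 (derive1 f).
Proof. by move=> sf k t; rewrite -derive1Sn; exact: (sf k.+1). Qed.

Lemma is_derive_lin {f g} (a : R) t : derivable f t 1 -> derivable g t 1 ->
  is_derive t 1 (fun s => a * f s + g s) (a * derive1 f t + derive1 g t).
Proof.
move=> /derivableP df /derivableP dg; rewrite !derive1E.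
exact: (is_deriveD (is_deriveZ a df) dg).
Qed.

Lemma derive1n_lin {f g} (a : R) k : smooth1 f -> smooth1 g ->
  derive1n k (fun s => a * f s + g s) =
  (fun s => a * derive1n k f s + derive1n k g s).
Proof.
move=> sf sg; elim: k => // k IH; rewrite derive1nS IH.
by apply/funext => t; rewrite derive1E; apply: derive_val; exact: is_derive_lin.
Qed.

Lemma smooth1_lin {f g} (a : R) : smooth1 f -> smooth1 g ->
  smooth1 (fun s => a * f s + g s).
Proof.
move=> sf sg k t; rewrite derive1n_lin//; apply: ex_derive.
exact: is_derive_lin.
Qed.

Lemma derive1n_cst0 k : derive1n k (fun=> 0 : R) = (fun=> 0).
Proof.
elim: k => // k IH; rewrite derive1nS IH; apply/funext => t.
by rewrite derive1E derive_cst.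
Qed.

Lemma smooth1_0 : smooth1 (fun=> 0).
Proof. by move=> k t; rewrite derive1n_cst0; exact: derivable_cst. Qed.

Lemma smooth1_sum {I : Type} (r : seq I) (F : I -> R -> R) :
  (forall i, smooth1 (F i)) -> smooth1 (fun t => \sum_(i <- r) F i t).
Proof.
move=> sF; elim: r => [|i r IH].
  by under eq_fun do rewrite big_nil; exact: smooth1_0.
rewrite (_ : (fun t => _) = fun t => 1 * F i t + \sum_(j <- r) F j t).
  exact: (smooth1_lin 1 (sF i) IH).
by apply/funext => t; rewrite big_cons mul1r.
Qed.

(** Lets operators of different degrees be compared coefficient by coefficient
    over a common index range. *)
Lemma poly_ddt_widen {n q f t} : (size q <= n)%N ->
  poly_ddt q f t = \sum_(k < n) q`_k * derive1n k f t.
Proof.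
move=> qn; rewrite /poly_ddt (big_ord_widen n (fun k => q`_k * derive1n k f t))//.
rewrite [RHS](bigID (fun k : 'I_n => (k < size q)%N))/= [X in _ + X]big1 ?addr0//.
by move=> i; rewrite -leqNgt => ?; rewrite nth_default// mul0r.
Qed.

Lemma poly_ddt0 f : poly_ddt 0 f = fun=> 0.
Proof. by apply/funext => t; rewrite /poly_ddt size_poly0 big_ord0. Qed.

Lemma poly_ddtD p q f t :
  poly_ddt (p + q) f t = poly_ddt p f t + poly_ddt q f t.
Proof.
pose n := maxn (size p) (size q).
rewrite !(@poly_ddt_widen n) ?leq_maxl ?leq_maxr//; last first.
  exact: size_polyD.
by rewrite -big_split; apply: eq_bigr => i _; rewrite coefD mulrDl.
Qed.

Lemma poly_ddtC c f : poly_ddt c%:P f = fun t => c * f t.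
Proof.
apply/funext => t; rewrite (@poly_ddt_widen 1) ?size_polyC_leq1//.
by rewrite big_ord1 coefC.
Qed.

Lemma poly_ddtCM c q f t : poly_ddt (c%:P * q) f t = c * poly_ddt q f t.
Proof.
rewrite (@poly_ddt_widen (size q)) ?mul_polyC ?size_scale_leq// mulr_sumr.
by apply: eq_bigr => k _; rewrite coefZ mulrA.
Qed.

Lemma poly_ddt_sum {I : Type} (r : seq I) (P : I -> {poly R}) f t :
  poly_ddt (\sum_(i <- r) P i) f t = \sum_(i <- r) poly_ddt (P i) f t.
Proof.
elim: r => [|i r IH]; first by rewrite !big_nil poly_ddt0.
by rewrite !big_cons poly_ddtD IH.
Qed.

Lemma poly_ddt_lin q {f g} a t : smooth1 f -> smooth1 g ->
  poly_ddt q (fun s => a * f s + g s) t = a * poly_ddt q f t + poly_ddt q g t.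
Proof.
move=> sf sg; rewrite /poly_ddt mulr_sumr -big_split /=.
apply: eq_bigr => k _; rewrite derive1n_lin// mulrDr.
by rewrite mulrCA.
Qed.

Lemma poly_ddt_fun0 q : poly_ddt q (fun=> 0) = fun=> 0.
Proof.
by apply/funext => t; rewrite /poly_ddt big1// => k _; rewrite derive1n_cst0 mulr0.
Qed.

Lemma poly_ddt_fsum {I : Type} (r : seq I) q (F : I -> R -> R) t :
  (forall i, smooth1 (F i)) ->
  poly_ddt q (fun s => \sum_(i <- r) F i s) t = \sum_(i <- r) poly_ddt q (F i) t.
Proof.
move=> sF; elim: r => [|i r IH].
  by rewrite big_nil; under eq_fun do rewrite big_nil; rewrite poly_ddt_fun0.
under eq_fun do rewrite big_cons -[F i _]mul1r.
by rewrite poly_ddt_lin ?IH ?mul1r ?big_cons//; exact: smooth1_sum.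
Qed.

Lemma smooth1_poly_ddt q {f} : smooth1 f -> smooth1 (poly_ddt q f).
Proof.
move=> sf; apply: smooth1_sum => k.
rewrite (_ : (fun t => _) = fun t => q`_k * derive1n k f t + 0); last first.
  by apply/funext => t; rewrite addr0.
apply: smooth1_lin smooth1_0 => j t.
by rewrite /derive1n -iterD; exact: sf.
Qed.

Lemma poly_ddtMX q f : poly_ddt (q * 'X) f = poly_ddt q (derive1 f).
Proof.
apply/funext => t; have [->|q0] := eqVneq q 0; first by rewrite mul0r !poly_ddt0.
rewrite /poly_ddt size_mulX// big_ord_recl coefMX mul0r add0r.
by apply: eq_bigr => i _; rewrite coefMX /= -derive1nS derive1Sn.
Qed.

(** By Horner induction on q: one factor X at a time becomes a derivative of f,
    and f' is again smooth. *)
Lemma poly_ddtM p q {f} : smooth1 f ->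
  poly_ddt (p * q) f = poly_ddt p (poly_ddt q f).
Proof.
elim/poly_ind: q f => [|q c IH] f sf.
  by rewrite mulr0 !poly_ddt0 poly_ddt_fun0.
have -> : poly_ddt (q * 'X + c%:P) f = fun s => c * f s + poly_ddt q (derive1 f) s.
  by apply/funext => s; rewrite poly_ddtD poly_ddtMX poly_ddtC addrC.
have sf' := smooth1_derive1 sf.
apply/funext => t; rewrite (poly_ddt_lin p c t sf (smooth1_poly_ddt q sf')).
rewrite mulrDr poly_ddtD mulrA poly_ddtMX IH// addrC; congr (_ + _).
by rewrite mulrC poly_ddtCM.
Qed.

End Scalar.

Section Vector.
Context {R : realType}.

Lemma smooth_mx_ddt {r n} (M : 'M[{poly R}]_(r, n)) (f : R -> 'cV[R]_n) :
  smooth f -> smooth (mx_ddt M f).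
Proof.
move=> sf i; under eq_fun do rewrite mxE.
by apply: smooth1_sum => j; apply: smooth1_poly_ddt; exact: sf.
Qed.

Lemma mx_ddtM {r n k} (M : 'M[{poly R}]_(r, n)) (N : 'M[{poly R}]_(n, k)) f :
  smooth f -> mx_ddt (M *m N) f = mx_ddt M (mx_ddt N f).
Proof.
move=> sf; apply/funext => t; apply/colP => i; rewrite !mxE.
under eq_bigr => j _.
  rewrite mxE poly_ddt_sum.
  under eq_bigr => l _ do rewrite (poly_ddtM _ _ (sf j)).
  over.
rewrite exchange_big /=; apply: eq_bigr => j _.
under [in RHS]eq_fun do rewrite mxE.
by rewrite (poly_ddt_fsum _ _ _ _ (fun l => smooth1_poly_ddt (N j l) (sf l))).
Qed.

Lemma mx_ddt_scalar {n} (c : {poly R}) (f : R -> 'cV[R]_n) t i :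
  mx_ddt c%:M f t i 0 = poly_ddt c (fun s => f s i 0) t.
Proof.
rewrite mxE (bigD1 i)//= mxE eqxx mulr1n big1 ?addr0// => j ji.
by rewrite mxE eq_sym (negbTE ji) mulr0n poly_ddt0.
Qed.

Lemma mx_ddt1 {n} (f : R -> 'cV[R]_n) : mx_ddt 1%:M f = f.
Proof.
apply/funext => t; apply/colP => i.
by rewrite mx_ddt_scalar -polyC1 poly_ddtC mul1r.
Qed.

Lemma mx_ddt_unit {n r k} (U : 'M[{poly R}]_n) (M : 'M[{poly R}]_(n, r)) (N : 'M[{poly R}]_(n, k))
    (f : R -> 'cV[R]_r) (g : R -> 'cV[R]_k) :
  U \in unitmx -> smooth f -> smooth g ->
  (mx_ddt (U *m M) f = mx_ddt (U *m N) g) <-> (mx_ddt M f = mx_ddt N g).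
Proof.
move=> uU sf sg; rewrite !mx_ddtM//; split=> [|->//].
move/(congr1 (mx_ddt (invmx U))).
rewrite -(mx_ddtM _ _ _ (smooth_mx_ddt M f sf)).
rewrite -(mx_ddtM _ _ _ (smooth_mx_ddt N g sg)).
by rewrite mulVmx// !mx_ddt1.
Qed.

End Vector.

(** * Surjectivity of nonzero operators *)

Section Ode.
Context {R : realType}.
Implicit Types (f g : R -> R) (p q : {poly R}).

(** The integral from a is an antiderivative only to the right of a. The base
    point therefore moves with x, and subtracting the integral up to 0 makes
    the value independent of it. *)
Lemma continuous_antiderivative f : continuous f ->
  exists F : R -> R, forall x : R, is_derive x 1 F (f x).
Proof.
move=> cf; pose mu := @lebesgue_measure R.
have intf a b : mu.-integrable `[a, b] (EFin \o f).
  apply: continuous_compact_integrable; first exact: segment_compact.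
  exact: continuous_subspaceT.
pose I a x := (\int[mu]_(t in `[a, x]) f t)%R.
have IB a b x : a <= b -> b <= x -> I a x - I a b = I b x.
  move=> ab bx; rewrite /I Rintegral_itvB//.
  by rewrite Rintegral_itv_obnd_cbnd//; apply: integrableS (intf b x) => //;
    exact: subset_itv_oc_cc.
have lo (x : R) : Num.min x 0 - 1 < x /\ Num.min x 0 - 1 < 0.
  by case: (leP x 0) => x0; split; lra.
pose F (x : R) := I (Num.min x 0 - 1) x - I (Num.min x 0 - 1) 0.
have FE (a x : R) : a < x -> a < 0 -> F x = I a x - I a 0.
  move=> ax a0; rewrite /F; set b := Num.min x 0 - 1.
  have [bx b0] : b < x /\ b < 0 := lo x.
  have [ab|/ltW ba] := leP a b.
    by rewrite -(IB a b x ab (ltW bx)) -(IB a b 0 ab (ltW b0)); ring.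
  by rewrite -(IB b a x ba (ltW ax)) -(IB b a 0 ba (ltW a0)); ring.
(* Near x, a fixed base point below both x and 0 can be used. *)
exists F => x; pose a := Num.min x 0 - 1.
have [ax a0] : a < x /\ a < 0 := lo x.
have [dI I'] : derivable (I a) x 1 /\ derive1 (I a) x = f x.
  apply: (@continuous_FTC1_closed _ f a x (x + 1)) => //.
  - by rewrite ltrDl.
  - exact: cf.
apply: (@near_eq_is_derive _ _ _ (fun y => I a y - I a 0)).
- by near=> y; rewrite (FE a y)//; near: y; exact: lt_nbhsr.
- rewrite -[f x]subr0 -I' derive1E.
  exact: (is_deriveB (derivableP dI) (is_derive_cst _ _ _)).
Unshelve. all: by end_near. Qed.

(** Bootstrapping: the derivatives (g', h') solve the same system with f' in
    place of f, so each further derivative exists by induction. *)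
Lemma pair_system_smooth {a b : R} {f g h} : smooth1 f ->
  (forall t : R, is_derive t 1 g (a * g t - b * h t + f t)) ->
  (forall t : R, is_derive t 1 h (b * g t + a * h t)) ->
  smooth1 g /\ smooth1 h.
Proof.
move=> sf dg dh; suff S k : forall f g h, smooth1 f ->
    (forall t : R, is_derive t 1 g (a * g t - b * h t + f t)) ->
    (forall t : R, is_derive t 1 h (b * g t + a * h t)) ->
    forall t, derivable (derive1n k g) t 1 /\ derivable (derive1n k h) t 1.
  by split=> k t; have [] := S k _ _ _ sf dg dh t.
elim: k => {f g h sf dg dh} [|k IH] f g h sf dg dh t.
  by split; apply: ex_derive.
have gE : derive1 g = fun t => a * g t - b * h t + f t.
  by apply/funext => s; rewrite derive1E; apply: derive_val; exact: dg.
have hE : derive1 h = fun t => b * g t + a * h t.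
  by apply/funext => s; rewrite derive1E; apply: derive_val; exact: dh.
rewrite (derive1Sn g) (derive1Sn h).
have dfs (s : R) : is_derive s 1 f (derive1 f s).
  by rewrite derive1E; apply/derivableP; exact: (sf 0 s).
have dgs (s : R) : is_derive s 1 g (derive1 g s) by rewrite gE; exact: dg.
have dhs (s : R) : is_derive s 1 h (derive1 h s) by rewrite hE; exact: dh.
apply: (IH (derive1 f) (derive1 g) (derive1 h) (smooth1_derive1 sf) _ _ t) => s.
- rewrite {1}gE.
  exact: (is_deriveD (is_deriveB (is_deriveZ a (dgs s)) (is_deriveZ b (dhs s)))
           (dfs s)).
- rewrite {1}hE.
  exact: (is_deriveD (is_deriveZ b (dgs s)) (is_deriveZ a (dhs s))).
Qed.

(** This is z' = (a + i b) z + f with z = g + i h, solved by variation of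
    constants: z = exp ((a + i b) t) times an antiderivative of
    exp (- (a + i b) t) f. *)
Lemma pair_system_onto (a b : R) f : smooth1 f ->
  exists g h, [/\ smooth1 g, smooth1 h,
    derive1 g = (fun t => a * g t - b * h t + f t)
    & derive1 h = (fun t => b * g t + a * h t)].
Proof.
move=> sf.
have df t : derivable f t 1 by exact: (sf 0).
have cE (c : R) : continuous (fun t : R => expR (c * t)).
  move=> t; apply: continuous_comp; last exact: continuous_expR.
  exact: mulrl_continuous.
have cf : continuous f by move=> t; apply/differentiable_continuous/derivable1_diffP.
have ccos : continuous (fun t : R => cos (b * t)).
  by move=> t; apply: continuous_comp; [exact: mulrl_continuous|exact: continuous_cos].
have csin : continuous (fun t : R => sin (b * t)).
  by move=> t; apply: continuous_comp; [exact: mulrl_continuous|exact: continuous_sin].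
(* F and - G are the real and imaginary parts of that antiderivative. *)
have [F dF] := @continuous_antiderivative
  (fun t => expR (- a * t) * cos (b * t) * f t)
  (fun t => cvgM (cvgM (cE (- a) t) (ccos t)) (cf t)).
have [G dG] := @continuous_antiderivative
  (fun t => expR (- a * t) * sin (b * t) * f t)
  (fun t => cvgM (cvgM (cE (- a) t) (csin t)) (cf t)).
pose g t := expR (a * t) * (cos (b * t) * F t + sin (b * t) * G t).
pose h t := expR (a * t) * (sin (b * t) * F t - cos (b * t) * G t).
have dmul (c t : R) : is_derive t 1 (fun s : R => c * s) c.
  by rewrite -[X in is_derive _ _ _ X]mulr1; exact: (is_deriveZ c (is_derive_id t 1)).
have dexp (t : R) : is_derive t 1 (fun s => expR (a * s)) (expR (a * t) * a).
  exact: (is_derive1_comp (is_derive_expR (a * t)) (dmul a t)).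
have dcos (t : R) : is_derive t 1 (fun s => cos (b * s)) (- sin (b * t) * b).
  exact: (is_derive1_comp (is_derive_cos (b * t)) (dmul b t)).
have dsin (t : R) : is_derive t 1 (fun s => sin (b * s)) (cos (b * t) * b).
  exact: (is_derive1_comp (is_derive_sin (b * t)) (dmul b t)).
have E (t : R) : expR (a * t) * expR (- a * t) = 1.
  by rewrite mulNr expRN mulfV// expR_eq0.
have dg (t : R) : is_derive t 1 g (a * g t - b * h t + f t).
  apply: (is_derive_eq (is_deriveM (dexp t)
    (is_deriveD (is_deriveM (dcos t) (dF t)) (is_deriveM (dsin t) (dG t))))).
  rewrite /g /h /GRing.scale !fctE/=.
  (* Inserts exp (a t) exp (- a t) (cos^2 + sin^2) = 1 in front of f t, after
     which both sides agree as polynomials. *)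
  rewrite -[X in _ = _ + X]mul1r -(E t) -[X in _ = _ + X * _]mulr1.
  rewrite -(cos2Dsin2 (b * t)); ring.
have dh (t : R) : is_derive t 1 h (b * g t + a * h t).
  apply: (is_derive_eq (is_deriveM (dexp t)
    (is_deriveB (is_deriveM (dsin t) (dF t)) (is_deriveM (dcos t) (dG t))))).
  rewrite /g /h /GRing.scale !fctE/=; ring.
have [sg sh] := pair_system_smooth sf dg dh.
exists g, h; split=> //; apply/funext => t; rewrite derive1E; exact: derive_val.
Qed.

Definition ddt_onto q := forall f, smooth1 f ->
  exists2 g, smooth1 g & poly_ddt q g = f.

Lemma ddt_ontoM p q : ddt_onto p -> ddt_onto q -> ddt_onto (p * q).
Proof.
move=> op oq f sf; have [g sg <-] := op f sf; have [h sh <-] := oq g sg.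
by exists h => //; exact: poly_ddtM.
Qed.

Lemma ddt_ontoC c : c != 0 -> ddt_onto c%:P.
Proof.
move=> c0 f sf; exists (fun t => c^-1 * f t + 0).
  exact: (smooth1_lin c^-1 sf smooth1_0).
by apply/funext => t; rewrite poly_ddtC addr0 mulVKf.
Qed.

Lemma poly_ddtXsubC a f t : poly_ddt ('X - a%:P) f t = derive1 f t - a * f t.
Proof.
rewrite -polyCN poly_ddtD -[X in poly_ddt X f t]mul1r poly_ddtMX -polyC1.
by rewrite !poly_ddtC mul1r mulNr.
Qed.

Lemma ddt_onto_linear a : ddt_onto ('X - a%:P).
Proof.
move=> f sf; have [g [h [sg _ dg _]]] := pair_system_onto a 0 f sf.
exists g => //; apply/funext => t; rewrite poly_ddtXsubC dg; ring.
Qed.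

(** Eliminating g from g' = a g - b h + f, h' = b g + a h leaves
    ((d/dt - a)^2 + b^2) h = b f, whence the forcing term b^-1 f below. *)
Lemma ddt_onto_quadratic a b : b != 0 ->
  ddt_onto (('X - a%:P) ^+ 2 + (b ^+ 2)%:P).
Proof.
move=> b0 f sf.
have sbf : smooth1 (fun t => b^-1 * f t + 0) := smooth1_lin b^-1 sf smooth1_0.
have [g [h [sg sh dg dh]]] := pair_system_onto a b _ sbf.
exists h => //; apply/funext => t.
have -> : poly_ddt (('X - a%:P) ^+ 2 + (b ^+ 2)%:P) h t =
    poly_ddt ('X - a%:P) (fun s => b * g s + 0) t + b ^+ 2 * h t.
  rewrite poly_ddtD poly_ddtC expr2 (poly_ddtM _ _ sh); congr (poly_ddt _ _ _ + _).
  by apply/funext => s; rewrite poly_ddtXsubC dh; ring.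
rewrite (poly_ddt_lin _ _ _ sg smooth1_0) poly_ddt_fun0 poly_ddtXsubC dg.
by field.
Qed.

(** A complex root a + i b of q yields the factor: its minimal polynomial over
    the reals divides q. *)
Lemma real_factor {q} : (1 < size q)%N -> exists2 d, d %| q &
  (exists a, d = 'X - a%:P) \/
  (exists a b, b != 0 /\ d = ('X - a%:P) ^+ 2 + (b ^+ 2)%:P).
Proof.
move=> q1; pose i : {rmorphism R -> complex R} := real_complex R.
have /closed_rootP[[a b] rz] : size (map_poly i q) != 1%N.
  by rewrite size_map_poly; case: (size q) q1 => [|[]].
have [b0|b0] := eqVneq b 0.
  exists ('X - a%:P); last by left; exists a.
  by rewrite dvdp_XsubCl -(fmorph_root i) -[i a]/(Complex a 0) -b0.
pose d := ('X - a%:P) ^+ 2 + (b ^+ 2)%:P; exists d; last by right; exists a, b.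
have sd : size d = 3%N.
  rewrite /d size_polyDl size_exp_XsubC// (leq_ltn_trans (size_polyC_leq1 _))//.
have d0 : d != 0 by rewrite -size_poly_gt0 sd.
have rd : (map_poly i d).[Complex a b] = 0.
  rewrite rmorphD rmorphXn rmorphB/= map_polyX !map_polyC !hornerE/=.
  by apply/eqP; rewrite eq_complex /=; apply/andP; split; apply/eqP => /=; ring.
have sr : (size (q %% d)%R <= 2)%N by rewrite -ltnS -sd ltn_modpN0.
move: rz; rewrite /root {1}(divp_eq q d) rmorphD rmorphM hornerD hornerM rd.
rewrite mulr0 add0r (@horner_coef_wide _ 2) ?size_map_poly//.
rewrite 2!big_ord_recl big_ord0 !coef_map/= /bump/= addr0 expr0 expr1 eq_complex /=.
move=> /andP[/eqP re0 /eqP im0].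
(* The remainder c0 + c1 X vanishes at a + i b with b nonzero, so c1 = 0 by the
   imaginary part and then c0 = 0 by the real part. *)
have r1 : (q %% d)`_1 = 0.
  apply: (mulIf b0); rewrite mul0r -[RHS]im0; ring.
have r0 : (q %% d)`_0 = 0 by rewrite -[RHS]re0 r1; ring.
rewrite /dvdp -size_poly_eq0 -leqn0; apply/leq_sizeP => -[_|[_|k _]] //.
by apply: nth_default; exact: leq_trans sr _.
Qed.

Lemma ddt_onto_neq0 q : q != 0 -> ddt_onto q.
Proof.
have [n] := ubnP (size q); elim: n q => // n IH q; rewrite ltnS => qn q0.
have [q1|q1] := leqP (size q) 1.
  by rewrite (size1_polyC q1); apply: ddt_ontoC; rewrite -polyC_eq0 -size1_polyC.
have [d dq dform] := real_factor q1.
have [od sd] : ddt_onto d /\ (1 < size d)%N.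
  case: dform => [[a ->]|[a [b [b0 ->]]]].
    by split; [exact: ddt_onto_linear|rewrite size_XsubC].
  split; first exact: ddt_onto_quadratic.
  by rewrite size_polyDl size_exp_XsubC// (leq_ltn_trans (size_polyC_leq1 _)).
have dn0 : d != 0 by rewrite -size_poly_gt0 ltnW.
have k0 : q %/ d != 0 by apply: contraNneq q0 => k0; rewrite -(divpK dq) k0 mul0r.
rewrite -(divpK dq); apply: ddt_ontoM od; apply: IH => //.
rewrite size_divp//; apply: leq_trans qn.
by rewrite ltn_subrL; case: (size d) sd => [|[]]//= m _; rewrite ltnW.
Qed.

End Ode.

Section MatrixOde.
Context {R : realType}.

(** The adjugate reduces the system to the scalar operator det P (d/dt), since
    P adj P is the scalar matrix det P. *)
Lemma mx_ddt_onto {n} {P : 'M[{poly R}]_n} {f : R -> 'cV[R]_n} :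
  \det P != 0 -> smooth f -> exists2 y, smooth y & mx_ddt P y = f.
Proof.
move=> dP sf.
have /choice[z zP] i : exists h, smooth1 h /\
    poly_ddt (\det P) h = (fun s => f s i 0).
  by have [h] := ddt_onto_neq0 _ dP _ (sf i); exists h.
pose w : R -> 'cV[R]_n := fun t => \col_i z i t.
have sw : smooth w.
  by move=> i; under eq_fun do rewrite mxE; exact: (zP i).1.
exists (mx_ddt (\adj P) w); first exact: smooth_mx_ddt.
rewrite -mx_ddtM// mul_mx_adj; apply/funext => t; apply/colP => i.
rewrite mx_ddt_scalar; under eq_fun do rewrite mxE.
by rewrite (zP i).2.
Qed.

End MatrixOde.

(** * Zero rows from dependent rows *)

Section Fractions.
Import generic_quotient FracField.
Local Open Scope quotient_scope.

Lemma frac_denominator {R : idomainType} (x : {fraction R}) :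
  exists2 d, d != 0 & exists e, tofrac d * x = tofrac e.
Proof.
elim/quotW: x => x; exists (frac x).2; first exact: denom_ratioP.
exists (frac x).1; unlock tofrac; rewrite -[LHS]pi_mul.
apply/eqmodP/eqP; rewrite /mulf !numden_Ratio ?oner_eq0 ?mul1r ?denom_ratioP//.
by rewrite !mulr1.
Qed.

End Fractions.

Section Rows.
Context {F : fieldType}.

Lemma transvection_unit {n} (i j : 'I_n) (a : {poly F}) : i != j ->
  1%:M + a *: delta_mx i j \in unitmx.
Proof.
move=> ij; have /mulmx1_unit[]// : (1%:M + a *: delta_mx i j) *m
  (1%:M - a *: delta_mx i j) = 1%:M.
  rewrite mulmxDl mul1mx mulmxBr mulmx1 -scalemxAl -scalemxAr.
  rewrite mul_delta_mx_cond eq_sym (negbTE ij) mulr0n !scaler0 subr0.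
  by rewrite subrK.
Qed.

(** Euclidean algorithm by column operations: while there are two nonzero
    entries, one of smallest degree reduces another modulo itself, which
    decreases the sum of the sizes. *)
Lemma row_euclid {n} {c : 'rV[{poly F}]_n} : c != 0 ->
  exists2 U, U \in unitmx & exists i g, g != 0 /\ c *m U = g *: delta_mx 0 i.
Proof.
pose w (c : 'rV[{poly F}]_n) := (\sum_j size (c ord0 j))%N.
have [N] := ubnP (w c); elim: N c => // N IH c; rewrite ltnS => wN c0.
have [i0 ci0] : exists i, c 0 i != 0.
  by apply/existsP; apply: contraNT c0 => /existsPn c0; apply/eqP/rowP => j;
    rewrite mxE; apply/eqP; exact/negPn/c0.
have [i ci min_i] := @arg_minnP _ i0 (fun k => c ord0 k != 0)
  (fun k => size (c ord0 k)) ci0.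
have [/existsP[j /andP[ji cj]]|/existsPn c1] :=
  boolP [exists j, (j != i) && (c 0 j != 0)]; last first.
  exists 1%:M; first exact: unitmx1.
  exists i, (c 0 i); split=> //; rewrite mulmx1; apply/rowP => j; rewrite !mxE.
  have := c1 j; have [->|ji /=] := eqVneq j i; first by rewrite mulr1.
  by rewrite negbK => /eqP ->; rewrite mulr0.
have le_ij := min_i j cj.
pose T := 1%:M + (- (c 0 j %/ c 0 i)) *: delta_mx i j.
have uT : T \in unitmx by apply: transvection_unit; rewrite eq_sym.
have cT k : (c *m T) 0 k = if k == j then (c 0 j %% c 0 i)%R else c 0 k.
  rewrite mulmxDr mulmx1 -scalemxAr [LHS]mxE [X in _ + X]mxE.
  have -> : (c *m delta_mx i j) 0 k = c 0 i *+ (k == j).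
    rewrite mxE (bigD1 i)//= big1 ?addr0 => [|l li].
      by rewrite mxE eqxx mulr_natr.
    by rewrite mxE (negbTE li) mulr0.
  have [->|_] := eqVneq k j; last by rewrite mulr0n mulr0 addr0.
  by rewrite mulr1n {1}(divp_eq (c 0 j) (c 0 i)) mulNr addrAC subrr add0r.
have cT0 : c *m T != 0.
  apply: contraNneq ci => /rowP/(_ i); rewrite cT mxE.
  by rewrite eq_sym (negbTE ji) => ->.
have wT : (w (c *m T) < N)%N.
  apply: leq_trans wN; rewrite /w (bigD1 j)//= [leqRHS](bigD1 j)//= cT eqxx.
  rewrite -addSn leq_add//.
    by apply: leq_trans le_ij; rewrite ltn_modpN0.
  by apply: leq_sum => k kj; rewrite cT (negbTE kj).
have [U uU [k [g [g0 E]]]] := IH (c *m T) wT cT0.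
exists (T *m U); first by rewrite unitmx_mul uT.
by exists k, g; rewrite mulmxA.
Qed.

Lemma clear_denominators {n} (v : 'rV[{fraction {poly F}}]_n) :
  exists (d : {poly F}) (c : 'rV[{poly F}]_n), d != 0 /\
    tofrac d *: v = map_mx (@tofrac _) c.
Proof.
have /fin_all_exists2[d d0 dP] j : exists2 d, d != 0 &
    exists e, tofrac d * v 0 j = tofrac e.
  exact: frac_denominator.
have /fin_all_exists[e eP] := dP.
exists (\prod_j d j), (\row_j (e j * \prod_(k | k != j) d k)); split.
  by apply/prodf_neq0 => j _.
apply/rowP => j; rewrite !mxE tofracM -eP (bigD1 j)//= tofracM.
by rewrite mulrAC.
Qed.

(** If c G = 0 and c U = g e_i with U unimodular, then g times row i of
    U^-1 G is zero, hence that row is zero. *)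
Lemma unimodular_zero_row {n k} {G : 'M[{poly F}]_(n, k)} :
  ~~ row_free (map_mx (@tofrac _) G) ->
  exists2 U, U \in unitmx & exists i, row i (U *m G) = 0.
Proof.
rewrite -kermx_eq0 => /rowV0Pn[v /sub_kermxP vG v0].
have [d [c [d0 dc]]] := clear_denominators v.
have cG : c *m G = 0.
  have : map_mx (@tofrac _) (c *m G) = 0.
    by rewrite map_mxM -dc -scalemxAl vG scaler0.
  move=> /matrixP cG0; apply/matrixP => i j; apply/eqP.
  by rewrite [eqbRHS]mxE -tofrac_eq0; have := cG0 i j; rewrite !mxE => ->.
have c0 : c != 0.
  apply: contraNneq v0 => c0; move: dc; rewrite c0 map_mx0 => /eqP.
  by rewrite scaler_eq0 tofrac_eq0 (negbTE d0).
have [U uU [i [g [g0 E]]]] := row_euclid c0.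
exists (invmx U); first by rewrite unitmx_inv.
exists i; have : g *: row i (invmx U *m G) = 0.
  by rewrite rowE scalemxAl -E mulmxA mulmxK// cG.
move/rowP => gr; apply/rowP => j; apply/(mulfI g0); have := gr j.
by rewrite !mxE mulr0.
Qed.

End Rows.

(** * Removing redundant guarantees *)

Section Reduction.
Context {R : realType}.

Lemma mx_ddt_row0 {r n} {M : 'M[{poly R}]_(r, n)} {i} (f : R -> 'cV[R]_n) t :
  row i M = 0 -> mx_ddt M f t i 0 = 0.
Proof.
move=> Mi; rewrite mxE big1// => j _.
by move/rowP/(_ j): Mi; rewrite !mxE => ->; rewrite poly_ddt0.
Qed.

Lemma mx_ddt_row' {r n k} (i : 'I_r.+1) (M : 'M[{poly R}]_(r.+1, n))
    (N : 'M[{poly R}]_(r.+1, k)) (f : R -> 'cV[R]_n) (g : R -> 'cV[R]_k) :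
  (forall t, mx_ddt M f t i 0 = mx_ddt N g t i 0) ->
  (mx_ddt (row' i M) f = mx_ddt (row' i N) g) <-> (mx_ddt M f = mx_ddt N g).
Proof.
have E l (L : 'M[{poly R}]_(r.+1, l)) e t j :
    mx_ddt (row' i L) e t j 0 = mx_ddt L e t (lift i j) 0.
  by rewrite !mxE; under eq_bigr do rewrite mxE.
move=> MNi; split=> MN; apply/funext => t; apply/colP => j; last first.
  by rewrite !E MN.
by case: (unliftP i j) => [l|] ->; rewrite ?MNi// -!E MN.
Qed.

(** Solvability of the system for all u in D is what allows an equation with
    zero left-hand side to be dropped: it is a consequence of u being in D. *)
Lemma full_row_rank_reduction {r m p} (G : 'M[{poly R}]_(r, p))
    (H : 'M[{poly R}]_(r, m)) (D : set (R -> 'cV[R]_m)) :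
  D `<=` @smooth R m ->
  (forall u, D u -> exists2 y, smooth y & mx_ddt G y = mx_ddt H u) ->
  exists S : system R m p, full_row_rank (out_mx S) /\
    forall u y, D u -> smooth y ->
      (mx_ddt G y = mx_ddt H u) <-> (mx_ddt (out_mx S) y = mx_ddt (in_mx S) u).
Proof.
move=> sD; elim: r G H => [|r IH] G H solv.
  exists (System G H); split=> //.
  by rewrite /full_row_rank /row_free; have := rank_leq_row (ratmx G); rewrite leqn0.
have [fG|] := boolP (row_free (ratmx G)); first by exists (System G H).
move=> /unimodular_zero_row[U uU [i Gi]].
have UE u y : D u -> smooth y ->
    (mx_ddt (U *m G) y = mx_ddt (U *m H) u) <-> (mx_ddt G y = mx_ddt H u).
  by move=> Du sy; apply: mx_ddt_unit => //; exact: sD.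
have Hi u t : D u -> mx_ddt (U *m H) u t i 0 = 0.
  move=> Du; have [y sy /(UE _ _ Du sy) <-] := solv u Du.
  exact: mx_ddt_row0.
have row'E u y : D u -> smooth y ->
    (mx_ddt (row' i (U *m G)) y = mx_ddt (row' i (U *m H)) u) <->
    (mx_ddt G y = mx_ddt H u).
  move=> Du sy; rewrite -UE//; apply: mx_ddt_row' => t.
  by rewrite mx_ddt_row0// Hi.
have [u Du|S [fS SE]] := IH (row' i (U *m G)) (row' i (U *m H)).
  by have [y sy Gy] := solv u Du; exists y => //; apply/row'E.
by exists S; split=> // u y Du sy; rewrite -SE// row'E.
Qed.

End Reduction.

Theorem lemma3 (R : realType) (m p : nat) (C : io_contract R m p) :
  consistent C ->
  env_behaviour (assumptions C) `<=` input_behaviour (guarantees C) /\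
  exists Gamma' : system R m p,
    full_row_rank (out_mx Gamma') /\
    behaviour (interconnect (assumptions C) (guarantees C)) =
    behaviour (interconnect (assumptions C) Gamma').
Proof.
move=> [_ [[P [Q [-> uP _]]] impl]].
have dP : \det P != 0.
  by move: uP; rewrite unitmxE det_map_mx unitfE tofrac_eq0.
have solv : env_behaviour (assumptions C) `<=` input_behaviour (guarantees C).
  move=> u Au; have [su _] := Au.
  have [y sy Py] := mx_ddt_onto dP (smooth_mx_ddt Q u su).
  exists y; apply: (impl (assumptions C)); first exact: subset_refl.
  by rewrite behaviour_interconnect.
split=> //.
have [||S [fS SE]] := full_row_rank_reduction (out_mx (guarantees C))
    (in_mx (guarantees C)) (env_behaviour (assumptions C)).
- by move=> u [].
- by move=> u /solv[y [_ sy Gy]]; exists y.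
exists S; split=> //; rewrite !behaviour_interconnect.
apply/seteqP; split=> -[u y] [[/= su sy uy] Au]; split=> //; split=> //=.
  by rewrite -SE.
by rewrite SE.
Qed.
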